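(* Let $G=[\mathfrak c]^{<\omega}$ be the Boolean group of all finite subsets of $\mathfrak c$ with symmetric difference as group operation. There exists a group topology on $G$ such that: (1) $G$ is Hausdorff; (2) $G$ is $\mathcal B$-cascade countably compact for each barrier $\mathcal B$ on $\omega$; (3) $G$ has no non-trivial convergent sequences; (4) $G^\omega$ is countably compact.
   Context: $\mathfrak c=2^{\aleph_0}$. A group topology is one making the group operation and inversion continuous. A convergent sequence is non-trivial if it is not eventually constant. For $a,b\subseteq\omega$, $a\sqsubseteq b$ means $a$ is an initial segment of $b$. A front on an infinite set $M\subseteq\omega$ is a family $\mathcal B\subseteq[M]^{<\omega}$ of finite subsets of $M$ that is a $\sqsubseteq$-antichain and such that every infinite $N\subseteq M$ has an initial segment $s\sqsubseteq N$ with $s\in\mathcal B$. A barrier on $M$ is a front on $M$ which is also a $\subseteq$-antichain. If $\mathcal B$ is a front on $M$ with $\emptyset\notin\mathcal B$ and $n\in M$, put $\mathcal B_{\{n\}}=\{t\setminus\{n\}:\{n\}\sqsubseteq t\in\mathcal B\}$; it is a front on $M\setminus(n+1)$ (a barrier if $\mathcal B$ is). The recursion passing from $\mathcal B$ to the $\mathcal B_{\{n\}}$ is well-founded and ends at fronts containing $\emptyset$ (i.e. $\mathcal B=\{\emptyset\}$). Cascade limits: let $X$ be a topological space, $\mathcal B$ a front on $M$, $p$ a free ultrafilter on $\omega$ with $M\in p$, and $f$ a function into $X$ whose domain contains $\mathcal B$. Recursively, $x\in X$ is a $\mathcal B$-cascade $p$-limit point of $f$ if: when $\emptyset\in\mathcal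 B$, $f(\emptyset)=x$; otherwise, there exist $A\in p$ with $A\subseteq M$ and a family $(x_n:n\in A)$ in $X$ such that for every $n\in A$, $x_n$ is a $\mathcal B_{\{n\}}$-cascade $p$-limit point of $f_n:\mathcal B_{\{n\}}\to X$, $f_n(s)=f(\{n\}\cup s)$, where $\mathcal B_{\{n\}}$ is seen as a front on $M\setminus(n+1)$, and $x$ is a $p$-limit of $(x_n:n\in A)$, i.e. $\{n\in A:x_n\in U\}\in p$ for every neighborhood $U$ of $x$. For a front $\mathcal B$ on $M$, $X$ is $\mathcal B$-cascade countably compact if for every $f:\mathcal B\to X$ there is a free ultrafilter $p$ on $\omega$ with $M\in p$ such that $f$ has a $\mathcal B$-cascade $p$-limit point in $X$. A space is countably compact if every sequence $(x_n:n\in\omega)$ in it has an accumulation point, i.e. a point each of whose neighborhoods contains $x_n$ for infinitely many $n$. *)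

(* Defs.v *)
From HB Require Import structures.
From mathcomp Require Import all_boot all_order all_algebra finmap.
From mathcomp Require Import all_classical topology.

Set Implicit Arguments.
Unset Strict Implicit.
Unset Printing Implicit Defensive.

Import GRing.Theory.
Local Open Scope classical_set_scope.

(* The Boolean group [T]^{<omega}; the alias keeps the group structure off
   {fset T} itself. *)
Definition boolean_group (T : choiceType) : Type := {fset T}.

HB.instance Definition _ (T : choiceType) :=
  Choice.copy (boolean_group T) {fset T}.

Section BooleanGroup.
Variable T : choiceType.
Implicit Types A B C : boolean_group T.

Definition symdiff A B : boolean_group T :=
  ((A `\` B) `|` (B `\` A))%fset.

Lemma in_symdiff A B x :
  (x \in (symdiff A B : {fset T})) =
  (x \in (A : {fset T})) (+) (x \in (B : {fset T})).
Proof. by rewrite !inE; case: (x \in A); case: (x \in B). Qed.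

Lemma symdiffA : associative symdiff.
Proof. by move=> A B C; apply/fsetP => x; rewrite !in_symdiff addbA. Qed.

Lemma symdiffC : commutative symdiff.
Proof. by move=> A B; apply/fsetP => x; rewrite !in_symdiff addbC. Qed.

Lemma symdiff0 : left_id (fset0%fset : boolean_group T) symdiff.
Proof. by move=> A; apply/fsetP => x; rewrite in_symdiff inE. Qed.

Lemma symdiffK : left_inverse (fset0%fset : boolean_group T) id symdiff.
Proof. by move=> A; apply/fsetP => x; rewrite in_symdiff addbb inE. Qed.

HB.instance Definition _ := GRing.isZmodule.Build (boolean_group T)
  symdiffA symdiffC symdiff0 symdiffK.

End BooleanGroup.

(* A topology on a fixed carrier is a term of the class [Topological G]; this
   is the resulting space. *)
Definition space_of (G : Type) (t : Topological G) : topologicalType :=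
  Topological.Pack t.

Definition group_topology (G : zmodType) (t : Topological G) : Prop :=
  let X := space_of t in
  continuous (fun z : X * X => ((z.1 : G) + (z.2 : G))%R : X) /\
  continuous (fun x : X => (- (x : G))%R : X).

Definition countably_compact (X : topologicalType) : Prop :=
  forall u : nat -> X, exists a : X,
    forall U : set X, nbhs a U -> infinite_set [set n | U (u n)].

Definition no_nontrivial_convergent_sequence (X : topologicalType) : Prop :=
  forall (u : nat -> X) (x : X), u @ \oo --> x ->
    exists c : X, \forall n \near \oo, u n = c.

Definition initial_segment (a b : set nat) : Prop :=
  a `<=` b /\ forall m n, a m -> b n -> (n < m)%N -> a n.

Definition front (M : set nat) (B : set {fset nat}) : Prop :=
  [/\ infinite_set M,
      forall s, B s -> [set` s] `<=` M,
      forall s t, B s -> B t -> initial_segment [set` s] [set` t] -> s = t &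
      forall N : set nat, infinite_set N -> N `<=` M ->
        exists2 s, B s & initial_segment [set` s] N].

Definition barrier (M : set nat) (B : set {fset nat}) : Prop :=
  front M B /\ forall s t, B s -> B t -> (s `<=` t)%fset -> s = t.

Definition front_at (B : set {fset nat}) (n : nat) : set {fset nat} :=
  [set s | exists t, [/\ B t, initial_segment [set n] [set` t] & s = (t `\ n)%fset]].

Definition free_ultrafilter (p : set_system nat) : Prop :=
  UltraFilter p /\ \bigcap_(A in p) A = set0.

(* Functions on a front are represented by total functions on {fset nat}, and
   families indexed by A by total functions on nat; only the values on the
   front (resp. on A) are used. The recursion on the front is well-founded, so
   the least relation closed under its two clauses is the intended one. *)
Inductive cascade_limit (X : topologicalType) (p : set_system nat) :
    set nat -> set {fset nat} -> ({fset nat} -> X) -> X -> Prop :=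
| cascade_limit_end (M : set nat) (B : set {fset nat}) (f : {fset nat} -> X) :
    B fset0%fset -> cascade_limit p M B f (f fset0%fset)
| cascade_limit_step (M : set nat) (B : set {fset nat}) (f : {fset nat} -> X)
    (x : X) (A : set nat) (u : nat -> X) :
    ~ B fset0%fset ->
    p A -> A `<=` M ->
    (forall n, A n ->
      cascade_limit p (M `&` [set m | (n < m)%N]) (front_at B n)
        (fun s => f (n |` s)%fset) (u n)) ->
    (forall U : set X, nbhs x U -> p (A `&` [set n | U (u n)])) ->
    cascade_limit p M B f x.

Definition cascade_countably_compact (X : topologicalType) (M : set nat)
    (B : set {fset nat}) : Prop :=
  forall f : {fset nat} -> X, exists p : set_system nat,
    [/\ free_ultrafilter p, p M & exists x : X, cascade_limit p M B f x].

(* Main.v *)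
Require Import Defs.
From HB Require Import structures.
From mathcomp Require Import all_boot ssralg finmap.
From mathcomp Require Import all_classical topology.

(** The topology is induced by a set of characters, that is, of homomorphisms
    into the two-element group.  For continuum many tasks, a task being a
    function on a front or a sequence in the countable power, an ultrafilter is
    fixed together with a countable family of sequences g and, for each of them,
    a limit; the characters are those that respect all these limits.  Group
    topology and the required limits are then automatic, and the point is that
    enough characters exist to separate 0 from every E <> 0.

    Choice of the limits.  Within one task, infinite sets M are shrunk, as in
    forcing with the infinite subsets of omega modulo finite sets.  A sequence h
    is decided by M if on M it is a constant plus a finite sum of earlier
    sequences, in which case its limit is the corresponding sum of limits; if M
    has no infinite subset deciding h in this way, then h is made to converge to
    a new coordinate, a singleton (decides_densely).  Countably many decisions
    can be made with one M, since decreasing sequences have pseudo-intersections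
    (densely_forall), so all levels of a cascade are settled by recursion on the
    front (cascades_densely).  The new coordinate assigned to a sequence is an
    injective function of the task and of the sequence, and comes after all
    coordinates used by the sequence; such a naming exists because the
    coordinates can be identified with the well-founded countably branching
    trees (nodes_exist).

    Choice of the ultrafilters.  Nontrivial sums of the sequences that received
    a new coordinate are finite-to-one on M, so M contains finite blocks, as
    large as desired, on which the vectors g m are linearly independent
    (block_exists).  The ultrafilter contains every set that omits only a small
    part of almost every block whose index lies on the branch of the task in the
    binary tree (block_ultrafilter).

    Separation (characters_separate).  Given E, only countably many tasks
    matter; their branches are almost disjoint, so each block has to serve one
    task only.  Going through the blocks in order, a counting argument in linear
    algebra shows that the relations between g m and the limit of g can be
    imposed on all but a small part of each block without capturing E in the
    span (extend_block, avoiding_span).  A homomorphism that kills the span but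
    not E is a character with the right limits for these tasks, and recursion
    along the order of the coordinates corrects it for the other tasks.

    A sequence a with infinitely many nonzero terms does not converge to 0: it
    would take each nonzero value only finitely often, and then the task of a
    makes it converge, along an ultrafilter, to a new coordinate, which is
    not 0. *)

Set Implicit Arguments.
Unset Strict Implicit.
Unset Printing Implicit Defensive.
Import GRing.Theory.
Local Open Scope classical_set_scope.
Local Open Scope card_scope.
Local Open Scope ring_scope.

(** * Finite and countable sets *)

Lemma finite_set_natP (A : set nat) :
  finite_set A <-> exists b, forall n, A n -> (n < b)%N.
Proof.
split=> [/finite_fsetP[s ->]|[b Ab]]; last exact: sub_finite_set (finite_II b).
exists (\max_(i <- s) i.+1)%N => n /= ns.
exact: (@leq_bigmax_seq _ (enum_fset s) xpredT succn n).
Qed.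

Lemma countableU1 (X : Type) (x : X) (A : set X) :
  countable A -> countable (x |` A).
Proof.
move=> cA.
rewrite (_ : _ |` _ = \bigcup_(b in [set: bool]) if b then [set x] else A).
  apply: bigcup_countable => [|[] _ //]; first exact: countableP.
apply/seteqP; split => [y [?|?]|y [[] _ ?]]; [by exists true | by exists false | by left | by right].
Qed.

Lemma countable_exhaustion (X : choiceType) (L : set X) : countable L ->
  exists S : nat -> {fset X},
    (forall n, (#|` S n|%fset <= n)%N /\ [set` S n] `<=` L) /\
    forall x, L x -> exists k, forall n, (k <= n)%N -> x \in S n.
Proof.
move=> /countable_injP[c cinj].
have [[x0 Lx0]|L0] := pselect (exists x, L x); last first.
  exists (fun=> fset0); split=> [n|x Lx]; last by exfalso; apply: L0; exists x.
  by rewrite cardfs0; split => // x; rewrite /= inE.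
have /choice[g gP] k : exists y, forall x, L x -> c x = k -> y = x.
  have [[x [Lx cx]]|nox] := pselect (exists x, L x /\ c x = k); last first.
    by exists x0 => x Lx cx; exfalso; apply: nox; exists x.
  by exists x => y Ly cy; apply: cinj; rewrite ?inE // cx cy.
pose s n := [seq g k | k <- iota 0 n & `[< L (g k) >]].
exists (fun n => [fset x in s n]%fset); split.
  move=> n; split.
    rewrite card_fseq (leq_trans (size_undup _)) // size_map size_filter.
    by rewrite (leq_trans (count_size _ _)) // size_iota.
  move=> x; rewrite /= inE => /mapP[k].
  by rewrite mem_filter => /andP[/asboolP Lgk _] ->.
move=> x Lx; exists (c x).+1 => n cn; rewrite inE; apply/mapP; exists (c x).
  by rewrite mem_filter mem_iota /= cn andbT; apply/asboolP; rewrite (gP _ x).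
by rewrite (gP _ x).
Qed.

(** * Linear extension over the two-element field *)

(** In a group of exponent two the sums over finite index sets are additive for
    the symmetric difference: [T]^<omega is the free such group on T. *)
Section LinearExtension.
Variables (X : choiceType) (V : zmodType).
Hypothesis addVV : forall v : V, v + v = 0.
Implicit Types (v : X -> V) (c d : boolean_group X).

Definition linext v c : V := \sum_(x <- (c : {fset X})) v x.

Lemma linext_incl v (D : {fset X}) c : ((c : {fset X}) `<=` D)%fset ->
  linext v c = \sum_(x <- D) v x *+ (x \in (c : {fset X})).
Proof.
move=> cD; rewrite /linext; under [RHS]eq_bigr do rewrite mulrb.
rewrite -big_mkcond /= -[RHS]big_filter; apply: perm_big; apply: uniq_perm.
- exact: fset_uniq.
- by rewrite filter_uniq.
move=> x; rewrite mem_filter; case: (boolP (x \in c)) => //= xc.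
by rewrite (fsubsetP cD).
Qed.

Lemma linextD v : {morph linext v : c d / c + d}.
Proof.
move=> c d; pose D := ((c : {fset X}) `|` d)%fset.
rewrite !(@linext_incl v D) ?fsubsetUl ?fsubsetUr //; last first.
  by apply/fsubsetP => x; rewrite in_symdiff in_fsetU; do 2!case: (x \in _).
rewrite -big_split; apply: eq_bigr => x _ /=; rewrite in_symdiff.
by case: (_ \in _); case: (_ \in _); rewrite /= ?mulr1n ?mulr0n ?addr0 ?add0r ?addVV.
Qed.

Lemma linext0 v : linext v 0 = 0.
Proof. exact: big_seq_fset0. Qed.

Lemma linext1 v x : linext v [fset x]%fset = v x.
Proof. exact: big_seq_fset1. Qed.

End LinearExtension.

Lemma linext_morph (X : choiceType) (V W : zmodType) (f : V -> W) (v : X -> V)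
    (c : boolean_group X) :
  {morph f : x y / x + y} -> f (linext v c) = linext (f \o v) c.
Proof.
move=> fD; have f0 : f 0 = 0.
  by have := fD 0 0; rewrite addr0 -[X in X = _]addr0 => /addrI.
by rewrite /linext (big_morph f fD f0).
Qed.

Lemma boolean_addxx (T : choiceType) (x : boolean_group T) : x + x = 0.
Proof. exact: symdiffK. Qed.

Lemma linext_single (T : choiceType) (x : boolean_group T) :
  x = linext (fun t => [fset t]%fset : boolean_group T) x.
Proof.
rewrite /linext; move: x; apply: fset1U_rect => [|t x tx IH].
  by rewrite big_seq_fset0.
rewrite big_fsetU1 //= -IH; apply/fsetP => u; rewrite in_symdiff !inE.
by case: eqP => //= ->; rewrite (negbTE tx).
Qed.

(** * Linear independence with bounded losses *)

Section Span.
Variables (V : zmodType).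
Hypothesis addVV : forall v : V, v + v = 0.
Implicit Types (ws : seq V) (x y w : V).

Lemma addVKV w x : x + w + w = x.
Proof. by rewrite -addrA addVV addr0. Qed.

Fixpoint span ws : set V :=
  if ws is w :: ws' then [set x | span ws' x \/ span ws' (x + w)] else [set 0].

Lemma span_0 ws : span ws 0.
Proof. by elim: ws => //= w ws IH; left. Qed.

Lemma spanD ws x y : span ws x -> span ws y -> span ws (x + y).
Proof.
elim: ws x y => [|w ws IH] x y /=; first by move=> -> ->; rewrite /= addr0.
move=> [hx|hx] [hy|hy].
- by left; apply: IH.
- by right; rewrite -addrA; apply: IH.
- by right; rewrite addrAC; apply: IH.
- by left; rewrite -[x + y](addVKV w) (_ : _ + w + w = (x + w) + (y + w));
    [apply: IH | rewrite -!addrA; congr (x + _); rewrite addrCA !addrA].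
Qed.

Lemma span_catr us ws x : span ws x -> span (us ++ ws) x.
Proof. by elim: us => //= u us IH /IH; left. Qed.

Lemma span_mem ws w : w \in ws -> span ws w.
Proof.
elim: ws => //= u ws IH; rewrite in_cons => /predU1P[->|/IH]; last by left.
by right; rewrite addVV; apply: span_0.
Qed.

Lemma span_catl us ws x : span us x -> span (us ++ ws) x.
Proof.
elim: us x => [|u us IH] x /=; first by move=> ->; apply: span_0.
by case=> /IH; [left|right].
Qed.

Lemma span_sum (X : choiceType) (v : X -> V) ws (c : boolean_group X) :
  (forall z, z \in (c : {fset X}) -> span ws (v z)) -> span ws (linext v c).
Proof.
move=> h; rewrite /linext big_seq_cond; elim/big_ind: _ => //.
- exact: span_0.
- exact: spanD.
- by move=> x; rewrite andbT; apply: h.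
Qed.

Section Blocks.
Variables (X : choiceType) (v : X * nat -> V) (S : {fset X}).
Implicit Types (I : {fset nat}) (W : set V) (c : boolean_group (X * nat)%type).

(** A family of vectors v (g, m) is handled in blocks S x I; a subset c of a
    block is the same thing as a linear combination of its vectors. *)
Definition inblock I c :=
  forall z, z \in (c : {fset X * nat}) -> z.1 \in S /\ z.2 \in I.

Definition indep W I := forall c, inblock I c -> W (linext v c) -> c = 0.

Lemma inblockD I c d : inblock I c -> inblock I d -> inblock I (c + d).
Proof.
move=> hc hd z; rewrite in_symdiff.
by case: (boolP (z \in c)) => [/hc //|_ /= /hd].
Qed.

Lemma inblockS I J c : (I `<=` J)%fset -> inblock I c -> inblock J c.
Proof. by move=> /fsubsetP IJ hc z /hc [? /IJ]. Qed.

(** Each further generator w can be accommodated by giving up a single index: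
    if some combination c of the block falls into span ws + w, then two such
    combinations differ by a combination in span ws, hence are equal, so
    removing an index that occurs in c destroys the only obstruction. *)
Lemma indep_remove ws I : indep [set 0] I ->
  exists2 I', (I' `<=` I)%fset &
    (#|` I `\` I'|%fset <= size ws)%N /\ indep (span ws) I'.
Proof.
move=> ind; elim: ws => [|w ws [J JI [cJ indJ]]] /=.
  by exists I => //; rewrite fsetDv cardfs0.
have [H|] := pselect (indep (span (w :: ws)) J).
  by exists J => //; split => //; apply: leqW.
move=> /existsNP[c /not_implyP[hc /not_implyP[/= sc c0]]].
have {}sc : span ws (linext v c + w).
  by case: sc => // /(indJ _ hc).
have [z zc] : exists z, z \in (c : {fset X * nat}).
  by apply/fset0Pn; apply/eqP => c00; apply: c0.
have [_ zJ] := hc _ zc.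
exists (J `\ z.2)%fset; first by apply: fsubset_trans JI; apply: fsubD1set.
split.
  rewrite (_ : I `\` _ = z.2 |` (I `\` J))%fset; last first.
    apply/fsetP => n; rewrite !inE; case: eqP => //= ->.
    by rewrite (fsubsetP JI).
  by rewrite cardfsU1; case: (_ \notin _); rewrite ?add1n ?add0n ?ltnS // leqW.
move=> d hd sd; have hd' : inblock J d by apply: inblockS hd; apply: fsubD1set.
case: sd => [/(indJ _ hd') //|sd].
have : span ws (linext v (c + d)).
  rewrite linextD // -(addVKV w (_ + _)).
  by rewrite -addrA addrACA; apply: spanD.
move=> /(indJ _ (inblockD hc hd')) /(congr1 (fun e => z \in (e : {fset X * nat}))).
rewrite in_symdiff zc inE addTb => /negbFE /hd[_].
by rewrite !inE eqxx.
Qed.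

Lemma span_map_linext (s : seq (X * nat)) (u : X * nat -> V) ws x :
  span (map u s ++ ws) x ->
  exists2 c : boolean_group (X * nat)%type,
    {subset (c : {fset X * nat}) <= s} & span ws (x + linext u c).
Proof.
elim: s x => [|z s IH] x /=; first by exists 0; rewrite ?linext0 ?addr0.
case=> /IH [c cs hc].
  by exists c => // y /cs; rewrite inE orbC => ->.
exists (c + ([fset z]%fset : boolean_group _)).
  move=> y; rewrite in_symdiff !inE; case: (boolP (y \in c)) => [/cs ->|_ /=].
    by rewrite orbT.
  by move=> ->.
by rewrite linextD // linext1 [linext u c + _]addrC addrA.
Qed.

(** The relations v (g, m) = target g are imposed for all g in S and for all
    but few m in I, without putting E into the span.  The lost indices are the
    price for making the block independent over everything that occurs in the
    relations: E, the targets of S, and the old generators. *)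
Lemma extend_block (target : X -> V) (E : V) (vs : seq V) I :
  ~ span vs E -> indep [set 0] I ->
  exists2 I', ((I' `<=` I)%fset /\ (#|` I `\` I'|%fset <= 1 + #|` S| + size vs)%N) &
  exists vs', [/\ (size vs' <= size vs + #|` S| * #|` I|)%N, ~ span vs' E,
    span vs `<=` span vs' &
    forall g m, g \in S -> m \in I' -> span vs' (v (g, m) + target g)].
Proof.
move=> hE ind; pose ws := E :: (map target S ++ vs).
have [I' I'I [cI' ind']] := indep_remove ws ind.
exists I'; first by split; [|rewrite (leq_trans cI') //= size_cat size_map].
pose u (z : X * nat) := v z + target z.1.
exists (map u [seq (g, m) | g <- S, m <- I'] ++ vs); split.
- rewrite size_cat size_map addnC leq_add2l size_allpairs leq_mul2l.
  by rewrite fsubset_leq_card ?orbT.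
- move=> /span_map_linext[c csub hc]; apply: hE.
  have cb : inblock I' c by move=> z /csub /allpairsP[[g m] [? ? ->]].
  suff c0 : c = 0 by move: hc; rewrite c0 linext0 addr0.
  apply: ind' => //.
  have ndc : span (map target S ++ vs) (linext (fun z => target z.1) c).
    apply: span_sum => z /cb [zS _]; apply: span_catl.
    by apply: span_mem; apply: map_f.
  have eqn : linext u c = linext v c + linext (fun z => target z.1) c.
    by rewrite /linext -big_split.
  right; rewrite addrC -(addVKV (linext (fun z => target z.1) c) (_ + _)).
  by apply: spanD ndc; rewrite -addrA -eqn; apply: span_catr.
- by move=> x; apply: span_catr.
- move=> g m gS mI; apply: span_catl; apply: span_mem.
  by apply/mapP; exists (g, m) => //; apply/allpairsP; exists (g, m).
Qed.

End Blocks.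

(** No nontrivial finite sum of members of L has a limit that is forced in
    advance by its values on M. *)
Definition finite_to_one_on (M : set nat) (L : set (nat -> V)) :=
  forall F : boolean_group (nat -> V), F <> 0 -> [set` (F : {fset nat -> V})] `<=` L ->
  forall x, finite_set (M `&` [set m | linext (fun g => g m) F = x]).

Definition evaluation (z : (nat -> V) * nat) : V := z.1 z.2.

(** The points of a block are picked one after another.  A new point m fails
    only if a nonempty subsum of the g m, g in S, meets the finite span of the
    vectors already there, and that excludes finitely many m. *)
Lemma block_exists (M : set nat) (L : set (nat -> V)) (S : {fset nat -> V}) N :
  infinite_set M -> finite_to_one_on M L -> [set` S] `<=` L ->
  exists I : {fset nat},
    [/\ #|` I|%fset = N, [set` I] `<=` M & indep evaluation S [set 0] I].
Proof.
move=> Minf ML SL; elim: N => [|N [I [cI IM ind]]].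
  exists fset0; split; rewrite ?cardfs0 //= => c hc _.
  apply/fsetP => z; rewrite inE; apply/negP => /hc [_].
  by rewrite inE.
pose bad := \bigcup_(F in [set` (fpowerset S `\ fset0)%fset])
  \bigcup_(c in [set` fpowerset (S `*` I)%fset])
  (M `&` [set m | linext (fun g => g m) F = linext evaluation c]).
have badf : finite_set (bad `|` [set` I]).
  rewrite finite_setU; split; last exact: finite_fset.
  apply: bigcup_finite => [|F /=]; first exact: finite_fset.
  rewrite in_fsetD1 fpowersetE => /andP[F0 FS].
  apply: bigcup_finite => [|c _]; first exact: finite_fset.
  apply: ML; first by apply/eqP.
  by move=> g gF; apply: SL; apply: (fsubsetP FS).
have [m [Mm]] : (M `\` (bad `|` [set` I])) !=set0.
  by apply: infinite_setN0; apply: infinite_setD.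
move=> /not_orP[mbad /= /negP mI].
exists (m |` I)%fset; split.
- by rewrite cardfsU1 mI cI add1n.
- by move=> k /=; rewrite !inE => /orP[/eqP -> //|/IM].
move=> c0 hc0 /= sum0.
pose F : boolean_group (nat -> V) := [fset z.1 | z in c0 & z.2 == m]%fset.
pose c : boolean_group ((nat -> V) * nat)%type := [fset z in c0 | z.2 != m]%fset.
have inF g : (g \in (F : {fset _})) = ((g, m) \in (c0 : {fset _})).
  apply/imfsetP/idP => [[[g' k] /=]|gm].
    by rewrite !inE /= => /andP[gk /eqP e] ->; rewrite -e.
  by exists (g, m) => //=; rewrite !inE gm /=.
pose d : boolean_group ((nat -> V) * nat)%type := [fset (g, m) | g in F]%fset.
have ind_d g k : ((g, k) \in (d : {fset _})) = (k == m) && (g \in (F : {fset _})).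
  apply/imfsetP/andP => [[g' /= gF [-> ->]] //|[/eqP -> gF]].
  by exists g.
(* The part of c0 over the new point m is isolated in d. *)
have c0E : c0 = c + d.
  apply/fsetP => -[g k]; rewrite in_symdiff ind_d !inE /= inF.
  by case: eqP => [->|_] /=; rewrite ?andbF ?andbT ?addbF.
have liftd : linext evaluation d = linext (fun g => g m) F.
  by rewrite /linext big_imfset //= => g g' _ _ [].
have cb : inblock S I c.
  move=> z; rewrite !inE /= => /andP[/hc0 [zS]]; rewrite !inE.
  by case: eqP => //= _ zI.
have F0 : F = 0.
  apply: contra_notP mbad => /eqP F0; exists F.
    rewrite /= in_fsetD1 F0 fpowersetE /=; apply/fsubsetP => g; rewrite inF => /hc0.
    by case.
  exists c; first by rewrite /=; rewrite fpowersetE; apply/fsubsetP => z /cb[zS zI]; rewrite inE zS zI.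
  split => //=; rewrite -liftd -[LHS](addVKV (linext evaluation c)).
  by rewrite [linext evaluation d + _]addrC -linextD // -c0E sum0 add0r.
have d0 : d = 0.
  by apply/fsetP => -[g k]; rewrite ind_d F0 !inE andbF.
have ec : c0 = c by rewrite c0E d0 addr0.
by rewrite ec; apply: ind; rewrite // -ec.
Qed.

End Span.

(** * Deciding limits along a shrinking infinite set *)

Section States.
Variables (V : zmodType).
Hypothesis addVV : forall v : V, v + v = 0.
Variable target : (nat -> V) -> V.

(** In a state (M, L) the set M is a promise that the ultrafilter to be chosen
    contains M, and L collects the sequences g that will converge to target g.
    States play the role of forcing conditions: M may shrink modulo finite
    sets, and L may grow. *)
Definition state := (set nat * set (nat -> V))%type.
Implicit Types (s t : state) (h : nat -> V) (F : boolean_group (nat -> V)).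

Definition good s :=
  [/\ infinite_set s.1, countable s.2 & finite_to_one_on s.1 s.2].

Definition ext s t := finite_set (t.1 `\` s.1) /\ s.2 `<=` t.2.

Lemma ext_refl s : ext s s.
Proof. by split => //; rewrite setDv; exact: finite_set0. Qed.

Lemma ext_trans s t u : ext s t -> ext t u -> ext s u.
Proof.
move=> [st1 st2] [tu1 tu2]; split; last exact: subset_trans tu2.
apply: (@sub_finite_set _ _ ((u.1 `\` t.1) `|` (t.1 `\` s.1))).
  by move=> m [um sm]; have [tm|tm] := pselect (t.1 m); [right|left].
by rewrite finite_setU.
Qed.

(** P is required of all further extensions, so that it survives later
    decisions. *)
Definition densely (P : state -> Prop) := forall s, good s ->
  exists t, [/\ good t, ext s t & forall u, ext t u -> P u].

(** The limit of h along any free ultrafilter containing M is then forced by the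
    targets. *)
Definition decides s h x := exists F, [set` (F : {fset _})] `<=` s.2 /\
  exists2 c, x = c + linext target F &
    finite_set (s.1 `&` [set m | h m <> c + linext (fun g => g m) F]).

Lemma decides_ext s t h x : ext s t -> decides s h x -> decides t h x.
Proof.
move=> [st1 st2] [F [Fs [c -> fin]]]; exists F; split.
  exact: subset_trans st2.
exists c => //; apply: (@sub_finite_set _ _ ((t.1 `\` s.1) `|`
  (s.1 `&` [set m | h m <> c + linext (fun g => g m) F]))).
  by move=> m [tm hm]; have [sm|sm] := pselect (s.1 m); [right|left].
by rewrite finite_setU.
Qed.

(** Either h agrees on an infinite subset of M with a constant plus a finite sum
    from L, and M is shrunk to that subset; or adding h to L keeps all
    nontrivial sums finite-to-one, and its limit becomes target h. *)
Lemma decides_densely h : densely (fun s => exists x, decides s h x).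
Proof.
move=> s [sinf sc sF].
suff [t [gt st [x dt]]] : exists t, [/\ good t, ext s t & exists x, decides t h x].
  by exists t; split => // u tu; exists x; apply: decides_ext dt.
have [[F [c [Fs Finf]]]|noF] := pselect (exists F c,
    [set` (F : {fset _})] `<=` s.2 /\
    infinite_set (s.1 `&` [set m | h m = c + linext (fun g => g m) F])).
  pose M := s.1 `&` [set m | h m = c + linext (fun g => g m) F].
  exists (M, s.2); split.
  - split => // F' F'0 F's x; apply: sub_finite_set (sF _ F'0 F's x).
    by apply: setSI; apply: subIsetl.
  - split => //=; rewrite (_ : _ `\` _ = set0) ?finite_set0 //.
    by apply/seteqP; split => // m [[]].
  - exists (c + linext target F), F; split => //; exists c => //=.
    rewrite (_ : _ `&` _ = set0) ?finite_set0 //.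
    by apply/seteqP; split => // m [[]].
have {}noF F c : [set` (F : {fset _})] `<=` s.2 ->
    finite_set (s.1 `&` [set m | h m = c + linext (fun g => g m) F]).
  by move=> Fs; apply: contra_notP noF => ?; exists F, c.
pose H : boolean_group (nat -> V) := [fset h]%fset.
exists (s.1, h |` s.2); split.
- split => //=; first exact: countableU1.
  move=> F F0 Fsub x.
  have [hF|hF] := boolP (h \in (F : {fset _})); last first.
    apply: sF => // g gF; case: (Fsub _ gF) => // gh.
    by move: hF; rewrite -gh gF.
  have Hs : [set` (F + H : {fset _})] `<=` s.2.
    move=> g /=; rewrite in_symdiff inE; case: eqP => [->|gh].
      by rewrite hF.
    by rewrite addbF => /Fsub[].
  apply: sub_finite_set (noF _ x Hs) => m [sm /= <-]; split => //=.
  by rewrite linextD // linext1 addrA addVV add0r.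
- by split; [rewrite /= setDv; exact: finite_set0 | right].
- exists (target h), H; split.
    by move=> g; rewrite /= inE => /eqP ->; left.
  exists 0; rewrite ?linext1 ?add0r //= (_ : _ `&` _ = set0) ?finite_set0 //.
  by apply/seteqP; split => // m [_] /=; rewrite linext1 add0r.
Qed.

(** The k-th element of N is taken from the intersection of M 0, ..., M k, which
    differs from M k by a finite set only. *)
Lemma pseudo_intersection (M : nat -> set nat) :
  (forall k, infinite_set (M k)) -> (forall k, finite_set (M k.+1 `\` M k)) ->
  exists2 N, infinite_set N & forall k, finite_set (N `\` M k).
Proof.
move=> Minf Mdec.
have fin i d : finite_set (M (i + d)%N `\` M i).
  elim: d => [|d IH]; first by rewrite addn0 setDv; exact: finite_set0.
  apply: (@sub_finite_set _ _
    ((M (i + d).+1 `\` M (i + d)%N) `|` (M (i + d)%N `\` M i))).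
    rewrite addnS => m [m1 m2].
    by have [m3|m3] := pselect (M (i + d)%N m); [right|left].
  by rewrite finite_setU.
have /choice[m mP] k : exists n, (k <= n)%N /\ forall i, (i <= k)%N -> M i n.
  pose bad := `I_k `|` \bigcup_(i in `I_k.+1) (M k `\` M i).
  have badf : finite_set bad.
    rewrite finite_setU; split; first exact: finite_II.
    by apply: bigcup_finite => // i /=; rewrite ltnS => /subnKC <-.
  have [n [Mn nbad]] : (M k `\` bad) !=set0.
    by apply: infinite_setN0; apply: infinite_setD.
  exists n; split; first by rewrite leqNgt; apply/negP => nk; apply: nbad; left.
  move=> i ik; apply: contra_notP nbad => Min; right; exists i => //=.
exists (range m) => [|k].
  move=> /finite_set_natP[b mb]; have := mb _ (ex_intro2 _ _ b I erefl).
  by rewrite ltnNge (mP b).1.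
apply: (@sub_finite_set _ _ (m @` `I_k)); last exact: finite_image.
move=> _ [[i _ <-] nM]; exists i => //=; rewrite ltnNge; apply/negP => ki.
by apply: nM; apply: (mP i).2.
Qed.

Lemma ext_limit (s : nat -> state) :
  (forall k, good (s k)) -> (forall k, ext (s k) (s k.+1)) ->
  exists2 t, good t & forall k, ext (s k) t.
Proof.
move=> gs es.
have [|k|N Ninf Ns] := @pseudo_intersection (fun k => (s k).1).
- by move=> k; have [] := gs k.
- by have [] := es k.
have mono i j : (i <= j)%N -> (s i).2 `<=` (s j).2.
  move=> /subnKC <-; elim: (j - i)%N => [|d IH]; first by rewrite addn0.
  by apply: subset_trans IH _; rewrite addnS; have [] := es (i + d)%N.
exists (N, \bigcup_k (s k).2); last first.
  by move=> k; split; [exact: Ns | move=> g gk; exists k].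
split => //=.
  by apply: bigcup_countable => [|k _]; [exact: countableP | have [] := gs k].
move=> F F0 Fs x.
have [k Fk] : exists k, [set` (F : {fset _})] `<=` (s k).2.
  have /choice[k kP] (g : nat -> V) : exists n, g \in (F : {fset _}) -> (s n).2 g.
    have [/Fs [n _ ?]|gF] := boolP (g \in (F : {fset _})); first by exists n.
    by exists 0%N.
  exists (\max_(g <- (F : {fset _})) k g)%N => g gF.
  apply: (@mono (k g)) (kP g gF).
  exact: (@leq_bigmax_seq _ (enum_fset F) xpredT k g).
apply: (@sub_finite_set _ _ (((s k).1 `&` [set m | linext (fun g => g m) F = x])
   `|` (N `\` (s k).1))).
  by move=> m [Nm xm]; have [|] := pselect ((s k).1 m); [left|right].
by rewrite finite_setU; split=> //; have [_ _] := gs k; apply.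
Qed.

(** Conditions are closed under limits of increasing sequences, so countably
    many dense requirements can be met at once. *)
Lemma densely_forall (P : nat -> state -> Prop) :
  (forall k, densely (P k)) -> densely (fun s => forall k, P k s).
Proof.
move=> dP s0 gs0.
pose S := {s | good s}.
have /choice[step stepP] (ks : nat * S) : exists t : S, ext (sval ks.2) (sval t) /\
    forall u, ext (sval t) u -> P ks.1 u.
  case: ks => k [s gs].
  by have [t [gt st Pt]] := dP k s gs; exists (exist _ t gt).
pose fix sq k : S := if k is k'.+1 then step (k', sq k') else exist _ s0 gs0.
have [|k|t gt st] := @ext_limit (fun k => sval (sq k)).
- by move=> k; exact: svalP.
- by have [] := stepP (k, sq k).
exists t; split => //; first exact: (st 0%N).
move=> u tu k; have [_] := stepP (k, sq k); apply.
exact: ext_trans (st k.+1) tu.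
Qed.

End States.

(** * The topology induced by a set of characters *)

Section InitialTopology.
Variable T : choiceType.
Local Notation G := (boolean_group T).
Variable Phi : set (G -> bool).

Definition initial_nbhs (x : G) : set_system G :=
  [set U | exists s : seq (G -> bool), (forall phi, phi \in s -> Phi phi) /\
     forall y, (forall phi, phi \in s -> phi y = phi x) -> U y].

(** A separate name for the carrier, so that the topology can be attached to it
    for a varying set Phi. *)
Definition initial_space : Type := G.

HB.instance Definition _ := Choice.copy initial_space G.
HB.instance Definition _ := hasNbhs.Build initial_space initial_nbhs.

Lemma initial_nbhs_filter (x : initial_space) : ProperFilter (nbhs x).
Proof.
split; first by move=> [s [_ /(_ x)]]; apply.
split; first by exists [::].
  move=> U W [s [sP sU]] [t [tP tW]]; exists (s ++ t); split.
    by move=> phi; rewrite mem_cat => /orP[/sP|/tP].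
  move=> y st; split; [apply: sU | apply: tW] => phi phis; apply: st;
  by rewrite mem_cat phis ?orbT.
by move=> U W UW [s [sP sU]]; exists s; split => // y /sU/UW.
Qed.

Lemma initial_nbhs_singleton (x : initial_space) (U : set initial_space) :
  nbhs x U -> U x.
Proof. by move=> [s [_]]; apply. Qed.

Lemma initial_nbhs_nbhs (x : initial_space) (U : set initial_space) :
  nbhs x U -> nbhs x (nbhs^~ U).
Proof.
move=> [s [sP sU]]; exists s; split => // y ys; exists s; split => // z zs.
by apply: sU => phi phis; rewrite zs ?ys.
Qed.

HB.instance Definition _ := Nbhs_isNbhsTopological.Build initial_space
  initial_nbhs_filter initial_nbhs_singleton initial_nbhs_nbhs.

Definition initial_topology_of : Topological G :=
  Topological.class (initial_space : topologicalType).

Local Notation X := (space_of initial_topology_of).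

Lemma initial_nbhs1 (x : X) phi : Phi phi -> nbhs x [set y | phi y = phi x].
Proof.
move=> Pphi; exists [:: phi]; split => [psi|y /(_ phi)]; rewrite inE.
  by move=> /eqP ->.
by rewrite eqxx; apply.
Qed.

Lemma initial_limit (p : set_system nat) (h : nat -> G) (x : G) :
  Filter p -> (forall phi, Phi phi -> p [set n | phi (h n) = phi x]) ->
  forall U : set X, nbhs (x : X) U -> p [set n | U (h n)].
Proof.
move=> Fp hx U [s [sP sU]]; suff : p [set n | forall phi, phi \in s -> phi (h n) = phi x].
  by apply: filterS => n; exact: sU.
elim: s sP {sU} => [|phi s IH] sP; first by apply: filterS filterT.
have ps := IH (fun psi psis => sP psi (@mem_behead _ (phi :: s) psi psis)).
apply: filterS (filterI (hx phi (sP phi (mem_head _ _))) ps) => n [e es] psi.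
by rewrite inE => /predU1P[->|/es].
Qed.

Hypothesis Phi_additive : forall phi, Phi phi -> {morph phi : x y / x + y}.

Lemma initial_group_topology : group_topology initial_topology_of.
Proof.
have oppG (x : G) : - x = x by [].
split; last by move=> x U; rewrite /= oppG => nU; apply: filterS nU => y.
move=> [x y] U [s [sP sU]].
pose A (z : X) := [set w : X | forall phi, phi \in s -> phi w = phi z].
have nA (z : X) : nbhs z (A z) by exists s.
exists (A x, A y); first by split; exact: nA.
move=> [x' y'] [/= Ax Ay]; apply: sU => phi phis.
by rewrite !(Phi_additive (sP _ phis)) Ax ?Ay.
Qed.

Lemma initial_hausdorff :
  (forall E : G, E <> 0 -> exists2 phi, Phi phi & phi E) -> hausdorff_space X.
Proof.
move=> sep x y clxy; apply: contrapT => xy.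
have addGG (z : G) : z + z = 0 by exact: symdiffK.
have [|phi Pphi] := sep ((x : G) + (y : G)).
  by move=> xy0; apply: xy; rewrite -[LHS](addVKV addGG (y : G)) xy0 add0r.
rewrite (Phi_additive Pphi).
have [z [/= <- ->]] := clxy _ _ (initial_nbhs1 x Pphi) (initial_nbhs1 y Pphi).
by rewrite [X in is_true X](addbb _).
Qed.

End InitialTopology.

(** * Cascade limits of a state *)

Lemma free_ultrafilter_cofinite (p : set_system nat) (A : set nat) :
  free_ultrafilter p -> finite_set A -> p (~` A).
Proof.
move=> [Up p0] /finite_fsetP[s ->].
have := @filter_bigI _ nat s (fun n => ~` [set n]) p _.
rewrite (_ : \bigcap_(i in _) _ = ~` [set` s]); last first.
  by apply/seteqP; split => n; [move=> h ns; exact: h ns erefl|move=> ns i si; apply: contra_not ns => ->].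
apply => n _; have [pn|//] := in_ultra_setVsetC [set n] Up; exfalso.
suff : (\bigcap_(B in p) B) n by rewrite p0.
move=> B pB; have [m [/= -> //]] := filter_ex (filterI pn pB).
Qed.

Section Realization.
Variable T : choiceType.
Local Notation G := (boolean_group T).
Variable target : (nat -> G) -> G.
Implicit Types (Phi : set (G -> bool)) (p : set_system nat).

(** The promises made by a state are kept by the ultrafilter p and by the
    topology induced by Phi. *)
Definition realizes (s : state G) Phi p := [/\ free_ultrafilter p, p s.1,
  forall phi, Phi phi -> {morph phi : x y / x + y} &
  forall g phi, s.2 g -> Phi phi -> p [set n | phi (g n) = phi (target g)]].

Lemma realizes_ext (s t : state G) Phi p : ext s t -> realizes t Phi p -> realizes s Phi p.
Proof.
move=> [st1 st2] [fp pt PhiD lim]; have [Up _] := fp; split => //.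
  apply: filterS (filterI pt (free_ultrafilter_cofinite fp st1)) => n [tn].
  by move=> nst; apply: contra_notP nst => ?; split.
by move=> g phi /st2; apply: lim.
Qed.

Lemma decides_limit s Phi p h x phi : realizes s Phi p -> decides target s h x ->
  Phi phi -> p [set n | phi (h n) = phi x].
Proof.
move=> [fp ps PhiD lim] [F [Fs [c -> fin]]] Pphi; have [Up _] := fp.
have phiD := PhiD _ Pphi.
have pF : p (\bigcap_(g in [set` (F : {fset nat -> G})])
    [set n | phi (g n) = phi (target g)]).
  by apply: filter_bigI => g /Fs sg; exact: lim.
apply: filterS (filterI (filterI ps (free_ultrafilter_cofinite fp fin)) pF).
move=> n [[sn hn] gn] /=.
rewrite (_ : h n = c + linext (fun g => g n) F); last first.
  by apply: contra_notP hn.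
rewrite !phiD !(linext_morph _ _ phiD); congr (_ + _).
by rewrite /linext; apply: eq_big_seq => g gF /=; exact: gn.
Qed.

(** The quantification over Phi and p lets x be found before the topology and
    the ultrafilter exist. *)
Definition cascades (s : state G) M B (h : {fset nat} -> G) x := forall Phi p,
  realizes s Phi p -> p M ->
  @cascade_limit (space_of (initial_topology_of Phi)) p M B h x.

Definition front_step (y x : set nat * set {fset nat}) :=
  ~ x.2 fset0 /\
  exists2 n, x.1 n & y = (x.1 `&` [set m | (n < m)%N], front_at x.2 n).

(** An infinite descent through the sections of a front would list an infinite
    set n 0 < n 1 < ... none of whose initial segments belongs to the front. *)
Lemma front_Acc M B : front M B -> Acc front_step (M, B).
Proof.
move=> [_ _ _ Mfront]; apply: contrapT => nacc0.
pose S := {x | ~ Acc front_step x}.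
have /choice[next nextP] (x : S) : exists y : nat * S, [/\ ~ (sval x).2 fset0,
    (sval x).1 y.1 & sval y.2 = ((sval x).1 `&` [set m | (y.1 < m)%N],
                                 front_at (sval x).2 y.1)].
  case: x => x nacc /=.
  apply: contra_notP nacc => noy; constructor => y [x0 [n xn ey]].
  by apply: contrapT => nacc; apply: noy; exists (n, exist _ y nacc).
pose sq := fix sq k : S := if k is k'.+1 then (next (sq k')).2 else exist _ (M, B) nacc0.
pose n k := (next (sq k)).1.
have sqM k : (sval (sq k)).1 (n k) by have [] := nextP (sq k).
have sqS k : sval (sq k.+1) = ((sval (sq k)).1 `&` [set m | (n k < m)%N],
                       front_at (sval (sq k)).2 (n k)).
  by have [] := nextP (sq k).
have subM k : (sval (sq k)).1 `<=` M.
  by elim: k => // k IH; rewrite sqS => m [/IH].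
have nS k : (n k < n k.+1)%N by have := sqM k.+1; rewrite sqS => -[].
have n_mono i j : (i < j)%N -> (n i < n j)%N.
  move=> /subnKC <-; elim: (j - i.+1)%N => [|d IH]; first by rewrite addn0.
  by rewrite addnS; exact: ltn_trans IH (nS _).
have n_ge k : (k <= n k)%N by elim: k => // k IH; exact: leq_ltn_trans IH (nS k).
pose N k := [set m | exists2 i, (k <= i)%N & m = n i].
(* An element of the k-th front that is an initial segment of the k-th tail
   would lose its least element at each step and reach the empty set. *)
have noseg d k s : #|` s|%fset = d -> (sval (sq k)).2 s ->
    initial_segment [set` s] (N k) -> False.
  elim: d k s => [|d IH] k s cs ss [sN seg].
    have [s0 _ _] := nextP (sq k); apply: s0.
    by move/eqP: cs; rewrite cardfs_eq0 => /eqP <-.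
  have nks : n k \in s.
    have [m ms] : exists m, m \in s.
      by apply/fset0Pn; rewrite -cardfs_eq0 cs.
    have [i ki mi] := sN _ ms.
    move: ki; rewrite leq_eqVlt => /predU1P[ki|ki]; first by rewrite ki -mi.
    by apply: (seg m) => //=; [exists k | rewrite mi n_mono].
  apply: (IH k.+1 (s `\ n k)%fset).
  - by apply/eqP; rewrite -(eqn_add2l 1) -[X in (X + _)%N]/(nat_of_bool true) -nks -cardfsD1 cs.
  - rewrite sqS /=; exists s; split => //; split; first by move=> _ ->.
    move=> m a /= -> /sN[i ki ->] nn; move: nn; rewrite ltnNge => /negP[].
    by move: ki; rewrite leq_eqVlt => /predU1P[->//|/n_mono/ltnW].
  - split=> [m /=|m a /=].
      rewrite !inE => /andP[mk /sN[i ki mi]]; exists i => //.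
      move: ki; rewrite leq_eqVlt => /predU1P[ki|//].
      by rewrite mi ki eqxx in mk.
    rewrite !inE => /andP[_ ms] [i ki ai] am; apply/andP; split.
      by rewrite ai neq_ltn (n_mono _ _ ki) orbT.
    by apply: (seg m) => //; exists i => //; apply: ltnW.
have [|m [i _ ->]|s Bs segs] := Mfront (N 0%N).
- move=> /finite_set_natP[b bP]; have := bP (n b) (ex_intro2 _ _ b (leq0n b) erefl).
  by rewrite ltnNge n_ge.
- exact: subM (sqM i).
- exact: (noseg #|` s|%fset 0%N s).
Qed.

(** Recursion on the front: first the limits over all sections are found, which
    are countably many dense requirements, and then the limit of the resulting
    sequence is decided. *)
Lemma cascades_densely M B (h : {fset nat} -> G) : Acc front_step (M, B) ->
  densely (fun s => exists x, cascades s M B h x).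
Proof.
have -> : M = (M, B).1 by []; have -> : B = (M, B).2 by [].
move: (M, B) => z acc; elim: acc h => {}z _ IH h s0 gs0.
have [z0|z0] := pselect (z.2 fset0).
  exists s0; split => //; first exact: ext_refl.
  by move=> u _; exists (h fset0) => Phi p _ _; exact: cascade_limit_end.
have step n : densely (fun s => exists x, z.1 n -> cascades s
    (z.1 `&` [set m | (n < m)%N]) (front_at z.2 n) (fun s => h (n |` s)%fset) x).
  have [zn|zn] := pselect (z.1 n); last first.
    by move=> s gs; exists s; split => // [|u _]; [exact: ext_refl | exists 0].
  move=> s gs; have fs : front_step (z.1 `&` [set m | (n < m)%N], front_at z.2 n) z.
    by split => //; exists n.
  have [t [gt st Pt]] := IH _ fs (fun s => h (n |` s)%fset) s gs.
  by exists t; split => // u /Pt[x]; exists x.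
have [s1 [gs1 s01 Ps1]] := densely_forall step gs0.
have /choice[u uP] := Ps1 _ (ext_refl s1).
have [s2 [gs2 s12 Ps2]] := decides_densely (@boolean_addxx T) target u gs1.
exists s2; split => // [|s3 s23]; first exact: ext_trans s12.
have [x dx] := Ps2 _ s23; exists x => Phi p rl pM.
have [[Up p0] _ _ _] := rl.
have rl1 : realizes s1 Phi p := realizes_ext (ext_trans s12 s23) rl.
apply: (@cascade_limit_step (space_of (initial_topology_of Phi)) p z.1 z.2 h x z.1 u) => //.
- move=> n zn; apply: uP => //; apply: filterI => //.
  apply: filterS (free_ultrafilter_cofinite (conj Up p0) (finite_II n.+1)) => m /=.
  by rewrite ltnS => /negP; rewrite -ltnNge.
- move=> U nU; apply: filterI => //.
  have lim phi : Phi phi -> p [set n | phi (u n) = phi x].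
    by move=> Pphi; exact: decides_limit rl dx Pphi.
  exact: (initial_limit _ lim nU).
Qed.

End Realization.

(** * Construction of homomorphisms and well-founded recursion *)

(** A subgroup that is maximal among those containing W but not e has index
    two, since any z outside it satisfies e + z in it. *)
Lemma additive_separation (V : zmodType) (addVV : forall v : V, v + v = 0)
    (W : set V) (e : V) :
  W 0 -> (forall x y, W x -> W y -> W (x + y)) -> ~ W e ->
  exists phi : V -> bool, [/\ {morph phi : x y / x + y}, phi e &
    forall x, W x -> phi x = false].
Proof.
move=> W0 WD We.
pose P (A : set V) := (forall x y, (A `|` W) x -> (A `|` W) y ->
  (A `|` W) (x + y)) /\ ~ (A `|` W) e.
have [F FP Ftot|A [[AD Ae] Amax]] := @Zorn_bigcup V P.
  split; last first.
    by move=> [[A FA Ae]|//]; have [_] := FP A FA; apply; left.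
  have lft A : F A -> A `|` W `<=` \bigcup_(X in F) X `|` W.
    by move=> FA x [Ax|]; [left; exists A|right].
  move=> x y [[A FA Ax]|Wx] [[B FB By]|Wy].
  - have [AB|BA] := Ftot A B FA FB.
      by apply: (lft B FB); apply: (FP B FB).1; left; [exact: AB|].
    by apply: (lft A FA); apply: (FP A FA).1; left; [|exact: BA].
  - by apply: (lft A FA); apply: (FP A FA).1; [left|right].
  - by apply: (lft B FB); apply: (FP B FB).1; [right|left].
  - by right; exact: WD.
set U := A `|` W in AD Ae.
have index2 z : ~ U z -> U (e + z).
  move=> Uz; apply: contrapT => Uez.
  pose B : set V := [set x | U x \/ U (x + z)].
  have zB : B z by right; rewrite addVV; right.
  have WB : B `|` W = B.
    by apply/seteqP; split => [x [//|Wx]|x]; left => //; right.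
  have AB : A `<` B.
    by split=> [x Ax|BA]; [left; left | apply: Uz; left; exact: BA].
  apply: (Amax B AB); split; rewrite WB; last by case.
  move=> x y [Ux|Ux] [Uy|Uy].
  - by left; exact: AD.
  - by right; rewrite -addrA; exact: AD.
  - by right; rewrite addrAC; exact: AD.
  - by left; rewrite -(addVKV addVV z (x + y)) -addrA addrACA; exact: AD.
exists (fun x => ~~ `[< U x >]); split.
- move=> x y; have [Ux|Ux] := pselect (U x); have [Uy|Uy] := pselect (U y).
  + by rewrite !asboolT //; exact: AD.
  + rewrite (asboolT Ux) !asboolF //; apply: contra_not Uy => Uxy.
    rewrite -(addVKV addVV x y) [y + x]addrC; exact: AD.
  + rewrite (asboolT Uy) !asboolF //; apply: contra_not Ux => Uxy.
    by rewrite -(addVKV addVV y x); exact: AD.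
  + rewrite (asboolF Ux) (asboolF Uy) asboolT //.
    rewrite -(addVKV addVV e (x + y)) -addrA addrACA [x + e]addrC [y + e]addrC.
    by apply: AD; exact: index2.
- by rewrite asboolF.
- by move=> x Wx; rewrite asboolT //; right.
Qed.

Lemma wf_recursion (X : Type) (R : X -> X -> Prop) (F : X -> (X -> bool) -> bool) :
  well_founded R ->
  (forall x u v, (forall y, R y x -> u y = v y) -> F x u = F x v) ->
  exists u, forall x, u x = F x u.
Proof.
move=> wfR Fext.
pose step x (rec : forall y, R y x -> bool) :=
  F x (fun y => if pselect (R y x) is left h then rec y h else false).
exists (Fix wfR (fun=> bool) step) => x; rewrite Fix_eq.
  by apply: Fext => y yx; case: pselect.
move=> y f g fg; apply: Fext => z zy.
by case: pselect.
Qed.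

(** * Ultrafilters on blocks *)

(** The three growth rates are tied together: with at most gens n generators
    present, a block for n sequences loses at most loss n of its bsize n points,
    and the rest contributes at most n * bsize n new generators.  As
    bsize n > n * loss n, no fixed multiple of the loss ever exhausts the
    blocks.  The definition of gens repeats the formulas of loss and bsize. *)
Fixpoint gens n := if n is k.+1 then (gens k + k * (k * (1 + k + gens k)).+1)%N else 0%N.
Definition loss n := (1 + n + gens n)%N.
Definition bsize n := (n * loss n).+1.

(** The sets that miss at most k * loss n points of the n-th block, for some k
    and almost all n in A, form a proper filter: the losses of two sets add up,
    and k * loss n < bsize n as soon as k <= n. *)
Lemma block_ultrafilter (A : set nat) (I : nat -> {fset nat}) :
  infinite_set A -> (forall n, #|` I n|%fset = bsize n) ->
  exists2 p, free_ultrafilter p & forall X : set nat,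
    (exists k, forall n, (k <= n)%N -> A n ->
       (#|` [fset m in I n | ~~ `[< X m >]]|%fset <= k * loss n)%N) -> p X.
Proof.
move=> Ainf cI.
pose F : set_system nat := [set X | exists k, forall n, (k <= n)%N -> A n ->
       (#|` [fset m in I n | ~~ `[< X m >]]|%fset <= k * loss n)%N].
have FF : ProperFilter F.
  split.
    move=> [k kP]; have [n [An kn]] : exists n, A n /\ (k <= n)%N.
      apply: contra_notP Ainf => nok; apply/finite_set_natP; exists k => n An.
      by rewrite ltnNge; apply/negP => kn; apply: nok; exists n.
    have := kP n kn An; rewrite (_ : [fset m in I n | _]%fset = I n).
      by rewrite cI /bsize ltnNge leq_mul2r kn orbT.
    by apply/fsetP => m; rewrite !inE asboolF // andbT.
  split.
  - exists 0%N => n _ _; rewrite (_ : [fset m in I n | _]%fset = fset0) ?cardfs0 //.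
    by apply/fsetP => m; rewrite !inE asboolT // andbF.
  - move=> X Y [k kP] [l lP]; exists (k + l)%N => n kln An.
    rewrite mulnDl (leq_trans _ (leq_add (kP n _ An) (lP n _ An))) //; last 2 first.
    + by rewrite (leq_trans _ kln) // leq_addr.
    + by rewrite (leq_trans _ kln) // leq_addl.
    rewrite -cardfsUI (leq_trans _ (leq_addr _ _)) // fsubset_leq_card //.
    apply/fsubsetP => m; rewrite !inE => /andP[-> /=].
    by rewrite asbool_and negb_and.
  - move=> X Y XY [k kP]; exists k => n kn An; apply: leq_trans (kP n kn An).
    apply: fsubset_leq_card; apply/fsubsetP => m; rewrite !inE => /andP[-> /=].
    by apply: contra => /asboolP /XY /asboolP.
have [p [Up Fp]] := ultraFilterLemma FF.
exists p; last by move=> X /Fp.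
split => //; apply/seteqP; split => // n np.
have : p (~` [set n]).
  apply: Fp; exists 1%N => k _ _; rewrite mul1n.
  apply: (@leq_trans #|` [fset n]|%fset); last by rewrite cardfs1.
  apply: fsubset_leq_card; apply/fsubsetP => m; rewrite !inE => /andP[_].
  by apply: contraR => mn; apply/asboolP; apply/eqP.
by move=> /np; apply.
Qed.

Definition branch (b : nat -> bool) : set nat :=
  [set n | exists l, n = choice.pickle (mkseq b l)].

Lemma branch_infinite b : infinite_set (branch b).
Proof.
have inj : injective (fun l => choice.pickle (mkseq b l)).
  by move=> l l' /(pcan_inj choice.pickleK) /(congr1 size); rewrite !size_mkseq.
move=> fin; apply: infinite_nat.
rewrite (_ : [set: nat] = (fun l => choice.pickle (mkseq b l)) @^-1` branch b).
  by apply: finite_preimage fin => ? ? _ _ /inj.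
by apply/seteqP; split => // l _; exists l.
Qed.

Lemma branch_almost_disjoint b b' : b <> b' ->
  exists k, forall n, branch b n -> branch b' n -> (n < k)%N.
Proof.
move=> bb'; have [i bi] : exists i, b i <> b' i.
  by apply: contra_notP bb' => noi; apply/funext => i; apply: contrapT => ?; apply: noi; exists i.
have fin : finite_set ((fun l => choice.pickle (mkseq b l)) @` `I_i.+1).
  exact: finite_image.
have /finite_set_natP[k kP] := fin; exists k => n [l ->] [l' /(pcan_inj choice.pickleK) e].
apply: kP; exists l => //=; rewrite ltnS leqNgt; apply/negP => il; apply: bi.
have ll' : l = l' by move/(congr1 size): e; rewrite !size_mkseq.
by move/(congr1 (nth false ^~ i)): e; rewrite !nth_mkseq -?ll'.
Qed.

(** Given countably many branches, each n can be assigned to one of them in such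
    a way that each branch owns almost all of its elements: n goes to the first
    branch through n, and the finitely many earlier branches meet a given one
    in a finite set. *)
Lemma branch_owner (Lab : Type) (code : Lab -> nat -> bool) (R : set Lab) :
  injective code -> countable R -> exists owner : nat -> option Lab,
    forall r, R r -> exists k, forall n, (k <= n)%N -> branch (code r) n ->
      owner n = Some r.
Proof.
move=> code_inj /countable_injP[c cinj].
have /choice[owner ownerP] n : exists o : option Lab, forall r, R r ->
    branch (code r) n -> (forall r', R r' -> branch (code r') n -> (c r <= c r')%N) ->
    o = Some r.
  have [[r [Rr rn rmin]]|nor] := pselect (exists r, [/\ R r, branch (code r) n &
      forall r', R r' -> branch (code r') n -> (c r <= c r')%N]).
    exists (Some r) => r' Rr' rn' rmin'; congr Some; apply: cinj; rewrite ?inE //.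
    by apply/eqP; rewrite eqn_leq rmin // rmin'.
  by exists None => r Rr rn rmin; exfalso; apply: nor; exists r.
exists owner => r Rr.
have /choice[bd bdP] k : exists b, forall r', R r' -> c r' = k -> r' <> r ->
    forall n, branch (code r) n -> branch (code r') n -> (n < b)%N.
  have [[r' [Rr' cr' rr']]|nor] := pselect (exists r', [/\ R r', c r' = k & r' <> r]).
    have [|b bP] := @branch_almost_disjoint (code r) (code r').
      by move=> /code_inj e; apply: rr'.
    exists b => r'' Rr'' cr'' _.
    by have -> : r'' = r' by apply: cinj; rewrite ?inE // cr' cr''.
  by exists 0%N => r' ? ? ?; exfalso; apply: nor; exists r'.
exists (\max_(k < c r) bd k)%N => n bn rn; apply: ownerP => // r' Rr' r'n.
rewrite leqNgt; apply/negP => lt; have rr' : r' <> r by move=> e; rewrite e ltnn in lt.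
have := bdP _ _ Rr' erefl rr' n rn r'n; rewrite ltnNge => /negP; apply.
exact: leq_trans (leq_bigmax (Ordinal lt)) bn.
Qed.

(** * The admissible characters separate points *)

Section Separation.
Variables (T : choiceType) (Lab : Type) (code : Lab -> nat -> bool).
Local Notation G := (boolean_group T).
Variable node : Lab -> (nat -> G) -> T.

(** The coordinate node r f is reserved for the limit of f under the r-th
    ultrafilter; it must come after all coordinates used by f. *)
Definition below x y := exists r f n, y = node r f /\ x \in (f n : {fset T}).

Hypothesis code_inj : injective code.
Hypothesis node_inj : forall r f r' f', node r f = node r' f' -> r = r' /\ f = f'.
Hypothesis below_wf : well_founded below.

Definition new_point r f : G := [fset node r f]%fset.

Variables (L : Lab -> set (nat -> G)) (S : Lab -> nat -> {fset nat -> G})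
  (I : Lab -> nat -> {fset nat}) (p : Lab -> set_system nat).
Hypothesis S_small : forall r n, (#|` S r n|%fset <= n)%N.
Hypothesis S_exhausts : forall r g, L r g ->
  exists k, forall n, (k <= n)%N -> g \in S r n.
Hypothesis I_size : forall r n, #|` I r n|%fset = bsize n.
Hypothesis I_indep : forall r n, indep (@evaluation G) (S r n) [set 0] (I r n).
Hypothesis p_free : forall r, free_ultrafilter (p r).
Hypothesis p_large : forall r (X : set nat),
  (exists k, forall n, (k <= n)%N -> branch (code r) n ->
     (#|` [fset m in I r n | ~~ `[< X m >]]|%fset <= k * loss n)%N) -> p r X.

Definition characters : set (G -> bool) := [set phi |
  {morph phi : x y / x + y} /\
  forall r g, L r g -> p r [set n | phi (g n) = phi (new_point r g)]].

Lemma below_closure_countable (E : G) : exists D : set T,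
  [/\ countable D, [set` (E : {fset T})] `<=` D &
      forall x y, D y -> below x y -> D x].
Proof.
pose D := fix D k := if k is k'.+1 then \bigcup_(y in D k') [set x | below x y]
  else [set` (E : {fset T})].
exists (\bigcup_k D k); split.
- apply: bigcup_countable => [|k _]; first exact: countableP.
  elim: k => [|k IH] /=; first exact/finite_set_countable/finite_fset.
  apply: bigcup_countable => // y _.
  have [[r [f ->]]|nof] := pselect (exists r f, y = node r f); last first.
    rewrite (_ : [set x | _] = set0); first exact: countable0.
    apply/seteqP; split => // x [r [f [n [yrf _]]]]; apply: nof.
    by exists r, f.
  apply: (@sub_countable _ _ _ (\bigcup_n [set` (f n : {fset T})])).
    apply: subset_card_le => x [r' [f' [n [/node_inj[_ <-] xf]]]].
    by exists n.
  apply: bigcup_countable => [|n _]; first exact: countableP.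
  exact/finite_set_countable/finite_fset.
- by move=> x xE; exists 0%N.
- by move=> x y [k _ Dy] xy; exists k.+1 => //; exists y.
Qed.

(** Treating the blocks in the order of their indices, each on behalf of its
    owner only, imposes the relations g m = new_point r g on all but loss n
    points of every owned block. *)
Lemma avoiding_span (E : G) (owner : nat -> option Lab) : E <> 0 ->
  exists W : set G, [/\ W 0, forall x y, W x -> W y -> W (x + y), ~ W E &
    forall n r, owner n = Some r -> exists2 I' : {fset nat},
      (#|` I r n `\` I'|%fset <= loss n)%N &
      forall g m, g \in S r n -> m \in I' -> W (g m + new_point r g)].
Proof.
move=> E0; have addGG := @boolean_addxx T.
pose inv n (vs : seq G) := (size vs <= gens n)%N /\ ~ span vs E.
have /choice[step stepP] (a : nat * seq G) : exists ws, inv a.1 a.2 ->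
    [/\ inv a.1.+1 ws, span a.2 `<=` span ws &
    forall r, owner a.1 = Some r -> exists2 I' : {fset nat},
      (#|` I r a.1 `\` I'|%fset <= loss a.1)%N &
      forall g m, g \in S r a.1 -> m \in I' -> span ws (g m + new_point r g)].
  case: a => n vs /=; have [[sz Evs]|] := pselect (inv n vs); last by exists [::].
  case on: (owner n) => [r|]; last first.
    by exists vs => _; split => //; split => //; rewrite (leq_trans sz) // leq_addr.
  have [I' [_ I'c] [ws [wsz wsE vws wsI]]] :=
    extend_block addGG (new_point r) Evs (@I_indep r n).
  exists ws => _; split => //.
    split => //; apply: leq_trans wsz _; rewrite I_size leq_add //.
    by rewrite leq_mul2r S_small orbT.
  move=> r' [<-]; exists I' => //; apply: leq_trans I'c _.
  by rewrite /loss leq_add // leq_add2l S_small.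
pose vs := fix vs n := if n is k.+1 then step (k, vs k) else [::].
have vsP n : inv n (vs n).
  by elim: n => [|n IH] /=; [split => //= ? | have [] := stepP (n, vs n) IH].
have mono n d : span (vs n) `<=` span (vs (n + d)%N).
  elim: d => [|d IH]; first by rewrite addn0.
  rewrite addnS; apply: subset_trans IH _.
  by have [] := stepP ((n + d)%N, vs (n + d)%N) (vsP _).
exists (\bigcup_n span (vs n)); split.
- by exists 0%N => //; exact: span_0.
- move=> x y [k _ kx] [l _ ly]; exists (k + l)%N => //.
  by apply: spanD => //; [exact: mono | rewrite addnC; exact: mono].
- by move=> [k _]; have [] := vsP k.
- move=> n r on; have [_ _ /(_ r on)[I' I'c I'P]] := stepP (n, vs n) (vsP n).
  by exists I' => // g m gS mI; exists n.+1 => //; exact: I'P.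
Qed.

(** Only countably many coordinates D lie below E, so only countably many labels
    matter for the value at E.  A character phi0 with phi0 E = 1 that obeys all
    relations for these labels is kept on D; on the other coordinates it is
    replaced, by recursion along below, by the limits that the ultrafilters
    prescribe. *)
Lemma characters_separate (E : G) : E <> 0 -> exists2 phi, characters phi & phi E.
Proof.
move=> E0; have addGG := @boolean_addxx T.
have [D [Dc ED Dbelow]] := below_closure_countable E.
pose R := \bigcup_(x in D) [set r | exists f, x = node r f].
have Rc : countable R.
  apply: bigcup_countable => // x _; apply/countable_injP; exists (fun=> 0%N).
  by move=> r r' /set_mem[f ->] /set_mem[f' /node_inj[]].
have [owner ownerP] := branch_owner code_inj Rc.
have [W [W0 WD WE WP]] := avoiding_span owner E0.
have [phi0 [phi0D phi0E phi0W]] := additive_separation addGG W0 WD WE.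
have phi0_lim r g : R r -> L r g -> p r [set n | phi0 (g n) = phi0 (new_point r g)].
  move=> Rr Lg; apply: p_large.
  have [k1 k1P] := ownerP r Rr; have [k2 k2P] := S_exhausts Lg.
  exists (k1 + k2).+1 => n kn rn.
  have k1n : (k1 <= n)%N by apply: leq_trans kn; rewrite leqW // leq_addr.
  have k2n : (k2 <= n)%N by apply: leq_trans kn; rewrite leqW // leq_addl.
  have [I' I'c I'P] := WP _ _ (k1P n k1n rn).
  apply: leq_trans (leq_trans I'c _); last by rewrite leq_pmull.
  apply: fsubset_leq_card; apply/fsubsetP => m; rewrite !inE => /andP[-> mX].
  rewrite andbT; apply: contra mX => mI; apply/asboolP => /=.
  have := phi0W _ (I'P _ _ (k2P n k2n) mI); rewrite phi0D.
  by case: (phi0 _); case: (phi0 _).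
pose F x (u : T -> bool) : bool := if `[< D x >] then phi0 [fset x]%fset else
  `[< exists r f, x = node r f /\ p r [set n | linext u (f n)] >].
have [|u uP] := wf_recursion (F := F) below_wf.
  move=> x u v uv; rewrite /F; case: ifP => // _; congr asbool.
  have uvf r f n : x = node r f -> linext u (f n) = linext v (f n).
    by move=> xrf; apply: eq_big_seq => y yf; apply: uv; exists r, f, n.
  apply/propext; split=> -[r [f [xrf pf]]]; exists r, f; split => //;
  by move: pf; congr (p r _); apply/seteqP; split => n /=; rewrite (uvf r f n xrf).
have addbb (b : bool) : b + b = 0 by case: b.
have uD x : D x -> u x = phi0 [fset x]%fset by move=> Dx; rewrite uP /F asboolT.
have phiD : {morph (linext u : G -> bool) : x y / x + y} by exact: linextD.
have phi0u (x : G) : [set` (x : {fset T})] `<=` D -> linext u x = phi0 x.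
  move=> xD; rewrite [in RHS](linext_single x) linext_morph //.
  by apply: eq_big_seq => t tx; rewrite uD //; exact: xD.
exists (linext u); last by rewrite phi0u.
split => // r g Lg; have [Up _] := p_free r.
have [Dx|Dx] := pselect (D (node r g)).
  have Rr : R r by exists (node r g) => //; exists g.
  have gD n : [set` (g n : {fset T})] `<=` D.
    by move=> y yg; apply: Dbelow Dx _; exists r, g, n.
  have pD : [set` (new_point r g : {fset T})] `<=` D.
    by move=> y; rewrite /= inE => /eqP ->.
  by apply: filterS (phi0_lim r g Rr Lg) => n /=; rewrite !phi0u.
have ux : linext u (new_point r g) = `[< p r [set n | linext u (g n)] >].
  rewrite linext1 uP /F asboolF //; congr asbool; apply/propext.
  by split=> [[r' [f' [/node_inj[<- <-]]]] //|pg]; exists r, g.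
rewrite ux; have [pg|npg] := in_ultra_setVsetC [set n | linext u (g n)] (p_free r).1.
  by rewrite asboolT //; apply: filterS pg => n /= ->.
have nf : ~ p r [set n | linext u (g n)].
  by move=> pg; have [n []] := filter_ex (filterI pg npg).
by rewrite asboolF //; apply: filterS npg => n /= /negP/negbTE.
Qed.

End Separation.

(** * Naming all sequences by coordinates *)

(** Well-founded countably branching trees with labels in 2^omega: there are
    continuum many, and a countable sequence of trees together with a label is
    again a tree.  Identifying the coordinates with trees replaces the usual
    bookkeeping along the ordinals below the continuum. *)
Inductive tree := leaf | branching of (nat -> bool) & (nat -> tree).

(** A tree is recovered from its values along finite paths; the subtrees are
    addressed from 1 on, which leaves the paths starting with 0 to the label. *)
Fixpoint tree_code (t : tree) (s : seq nat) : bool :=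
  match t, s with
  | leaf, _ => false
  | branching _ _, [::] => true
  | branching b _, 0%N :: s' => b (head 0%N s')
  | branching _ g, k.+1 :: s' => tree_code (g k) s'
  end.

Lemma tree_code_inj : injective tree_code.
Proof.
elim=> [|b g IH] [|b' g'] e //.
- by have := congr1 (@^~ [::]) e.
- by have := congr1 (@^~ [::]) e.
congr branching; apply/funext => k.
  exact: (congr1 (fun c : seq nat -> bool => c [:: 0; k]%N) e).
by apply: IH; apply/funext => s; exact: (congr1 (fun c : seq nat -> bool => c (k.+1 :: s)) e).
Qed.

Lemma card_tree : [set: tree] #= [set: nat -> bool].
Proof.
apply: Cantor_Bernstein.
  apply/pcard_injP; exists (fun t n =>
    if choice.unpickle n is Some s then tree_code t s else false).
  move=> t t' _ _ e; apply: tree_code_inj; apply/funext => s.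
  have := congr1 (fun c : nat -> bool => c (choice.pickle s)) e.
  by cbv beta; rewrite choice.pickleK.
apply: (@card_le_trans _ _ _ (range (fun b => branching b (fun=> leaf)))); last first.
  exact: card_leT.
have := @inj_card_eq _ _ [set: nat -> bool] (fun b => branching b (fun=> leaf)).
by rewrite card_eq_le => /(_ _)/andP[|//] b b' _ _ [].
Qed.

Lemma node_on_continuum (T : choiceType) : [set: T] #= [set: nat -> bool] ->
  exists node : (nat -> bool) -> (nat -> T) -> T,
    (forall b g b' g', node b g = node b' g' -> b = b' /\ g = g') /\
    well_founded (fun x y => exists b g k, y = node b g /\ x = g k).
Proof.
move=> cT; have /card_set_bijP[f] := cT; rewrite setTT_bijective => -[f' fK f'K].
have /card_set_bijP[h] := card_tree; rewrite setTT_bijective => -[h' hK h'K].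
pose toT t := f' (h t); pose ofT x := h' (f x).
have toTK : cancel toT ofT by move=> t; rewrite /ofT /toT f'K hK.
have ofTK : cancel ofT toT by move=> x; rewrite /ofT /toT h'K fK.
exists (fun b g => toT (branching b (ofT \o g))); split.
  move=> b g b' g' /(can_inj toTK)[-> gg']; split => //.
  by apply/funext => k; apply: (can_inj ofTK); exact: (congr1 (fun c : nat -> tree => c k) gg').
move=> y; rewrite -(ofTK y); elim: (ofT y) => [|b g IH]; constructor=> x.
  by move=> [b [g [k [/(can_inj toTK)]]]].
move=> [b' [g' [k [/(can_inj toTK)[_ eg] ->]]]].
by rewrite -(ofTK (g' k)) -[ofT (g' k)]/((ofT \o g') k) -eg; exact: IH.
Qed.

Section Nodes.
Variable T : choiceType.
Hypothesis cardT : [set: T] #= [set: nat -> bool].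
Local Notation G := (boolean_group T).

(** A label is a task: a code for a front, and an enumeration of the values to
    which limits have to be assigned. *)
Definition label : Type := ((nat -> bool) * (nat -> G))%type.

Lemma ltn_ext (m n : nat) : (forall i, (i < m)%N = (i < n)%N) -> m = n.
Proof.
move=> mn; have := mn m; have := mn n; rewrite !ltnn => h1 h2.
by apply/eqP; rewrite eqn_leq (leqNgt m) (leqNgt n) h1 -h2.
Qed.

Lemma countable_packing (J : countType) (Y : Type) (y0 : Y) :
  exists (i : J -> nat) (pack : (J -> Y) -> nat -> Y), forall f j, pack f (i j) = f j.
Proof.
exists choice.pickle, (fun f n => oapp f y0 (choice.unpickle n)) => f j.
by rewrite choice.pickleK.
Qed.

(** A label and a sequence of finite sets of coordinates amount to one point of
    2^omega and one sequence of coordinates, that is, to one tree. *)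
Lemma nodes_exist : exists (node : label -> (nat -> G) -> T)
    (code : label -> nat -> bool),
  [/\ injective code,
      forall r f r' f', node r f = node r' f' -> r = r' /\ f = f' &
      well_founded (below node)].
Proof.
have [node [node_inj node_wf]] := node_on_continuum cardT.
have /card_set_bijP[f0] := cardT; rewrite setTT_bijective => -[f0' f0K f0'K].
pose x0 := f0' (fun=> false).
pose sel (a f : nat -> G) (t : bool) (k : nat) : seq T :=
  enum_fset (if t then a k else f k).
have [ib [packb packbK]] := countable_packing (nat + bool * nat * nat)%type false.
have [ip [packp packpK]] := countable_packing (bool * nat * nat)%type x0.
(* A finite set of coordinates is stored through its enumeration by pts, and
   bits records where the enumeration stops. *)
pose bits b a f := packb (fun j => match j with
  inl k => b k | inr (t, k, i) => (i < size (sel a f t k))%N end).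
pose pts a f := packp (fun z => nth x0 (sel a f z.1.1 z.1.2) z.2).
pose nodeG (r : label) f := node (bits r.1 r.2 f) (pts r.2 f).
have nodeG_inj r f r' f' : nodeG r f = nodeG r' f' -> r = r' /\ f = f'.
  case: r r' => [b a] [b' a'] /node_inj /= [eb eg].
  have selE t k : sel a f t k = sel a' f' t k.
    apply: (@eq_from_nth _ x0) => [|i _].
      apply: ltn_ext => i.
      have := congr1 (fun c : nat -> bool => c (ib (inr (t, k, i)))) eb.
      by rewrite /bits !packbK.
    have := congr1 (fun c : nat -> T => c (ip (t, k, i))) eg.
    by rewrite /pts !packpK.
  split; last by apply/funext => k; apply: val_inj; exact: (selE false k).
  congr pair; apply/funext => k; last by apply: val_inj; exact: (selE true k).
  have := congr1 (fun c : nat -> bool => c (ib (inl k))) eb.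
  by rewrite /bits !packbK.
exists nodeG, (fun r => f0 (nodeG r (fun=> 0))); split; [|exact: nodeG_inj|].
  by move=> r r' /(can_inj f0K) /nodeG_inj[].
move=> y; elim: (node_wf y) => {}y _ IH; constructor=> x [r [f [n [yrf xf]]]].
apply: IH; exists (bits r.1 r.2 f), (pts r.2 f), (ip (false, n, index x (f n))).
by split; [exact: yrf | rewrite /pts packpK /= nth_index].
Qed.

End Nodes.

(** * Assembling the group *)

Section Assembly.
Variable T : choiceType.
Local Notation G := (boolean_group T).
Variable target : (nat -> G) -> G.
Implicit Type a : nat -> G.

(** Starting from L = {a} guarantees that a converges to target a.  This rules
    out convergent sequences: if a tended to 0, then target a would be 0. *)
Definition initial_state a : state G :=
  if pselect (infinite_set [set n | a n <> 0] /\
              forall x, x <> 0 -> finite_set [set n | a n = x])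
  is left _ then ([set n | a n <> 0], [set a]) else ([set: nat], set0).

Lemma initial_state_good a : good (initial_state a).
Proof.
rewrite /initial_state; case: pselect => [[ainf afin]|_]; split => //=.
- move=> F F0 Fa x.
  have -> : F = [fset a]%fset.
    apply/fsetP => g; rewrite inE; apply/idP/eqP => [/Fa //|->].
    have [g' gF] : exists g, g \in (F : {fset _}) by apply/fset0Pn/eqP.
    by rewrite -(Fa _ gF).
  have [->|/eqP x0] := eqVneq x 0.
    rewrite (_ : _ `&` _ = set0) ?finite_set0 //.
    by apply/seteqP; split => // m [/= am0]; rewrite linext1.
  by apply: sub_finite_set (afin x x0) => m [_ /=]; rewrite linext1.
- exact: infinite_nat.
- move=> F F0 Fa x; exfalso; apply: F0; apply/fsetP => g; rewrite inE.
  by apply/negP => /Fa.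
Qed.

Definition coded_front (b : nat -> bool) : set {fset nat} :=
  [set s | b (choice.pickle s)].

(** One state serves both purposes of the task: the sequence r.2 is read once as
    a function on the finite sets, for the cascade limit, and once as a sequence
    of sequences, for the countable power. *)
Lemma label_state (r : label T) : exists s : state G,
  [/\ good s, ext (initial_state r.2) s,
      front [set: nat] (coded_front r.1) -> exists x,
        cascades target s [set: nat] (coded_front r.1) (fun t => r.2 (choice.pickle t)) x &
      forall k : nat, exists x, decides target s (fun m => r.2 (choice.pickle (k, m))) x].
Proof.
pose P k s := if k is k'.+1 then
    exists x, decides target s (fun m => r.2 (choice.pickle (k', m))) x
  else front [set: nat] (coded_front r.1) -> exists x,
    cascades target s [set: nat] (coded_front r.1) (fun t => r.2 (choice.pickle t)) x.
have Pd k : densely (P k).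
  case: k => [|k] /=; last exact: decides_densely (@boolean_addxx T) _ _.
  have [B|nB] := pselect (front [set: nat] (coded_front r.1)); last first.
    by move=> s gs; exists s; split => // [|u _ /nB //]; exact: ext_refl.
  move=> s gs; have [t [gt st Pt]] :=
    cascades_densely target (fun t => r.2 (choice.pickle t)) (front_Acc B) gs.
  by exists t; split => // u /Pt Pu _.
have [s [gs rs Ps]] := densely_forall Pd (initial_state_good r.2).
have {}Ps := Ps s (ext_refl s).
by exists s; split => //; [exact: (Ps 0%N) | move=> k; exact: (Ps k.+1)].
Qed.

End Assembly.

Lemma ptws_nbhs_limit (X : topologicalType) (p : set_system nat) (u : nat -> nat -> X)
    (a : nat -> X) : ProperFilter p ->
  (forall k (U : set X), nbhs (a k) U -> p [set n | U (u n k)]) ->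
  forall U : set {ptws nat -> X}, nbhs (a : {ptws nat -> X}) U -> p [set n | U (u n)].
Proof.
move=> Fp lim.
have : (u : nat -> {ptws nat -> X}) @ p --> (a : {ptws nat -> X}).
  apply/cvg_sup => k U [W [[O oO <-] /= Oa] WU].
  apply: (filterS WU); apply: lim; exact: open_nbhs_nbhs.
by move=> h U /h.
Qed.

Theorem theorem6p22 (T : choiceType) (cardT : [set: T] #= [set: nat -> bool]) :
  exists tau : Topological (boolean_group T),
    let G := space_of tau in
    [/\ group_topology tau,
        hausdorff_space G,
        forall B : set {fset nat}, barrier [set: nat] B ->
          cascade_countably_compact G [set: nat] B,
        no_nontrivial_convergent_sequence G &
        countably_compact {ptws nat -> G}].
Proof.
have [node [code [code_inj node_inj node_wf]]] := nodes_exist cardT.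
pose target := new_point node.
have /choice[st stP] := fun r => label_state (target r) r.
have /choice[S SP] r : exists S : nat -> {fset nat -> boolean_group T},
    (forall n, (#|` S n|%fset <= n)%N /\ [set` S n] `<=` (st r).2) /\
    forall g, (st r).2 g -> exists k, forall n, (k <= n)%N -> g \in S n.
  by apply: countable_exhaustion; have [[]] := stP r.
have /choice[I IP] (a : label T * nat) : exists I : {fset nat},
    [/\ #|` I|%fset = bsize a.2, [set` I] `<=` (st a.1).1 &
        indep (@evaluation _) (S a.1 a.2) [set 0] I].
  case: a => r n; have [[Minf _ ML] _ _ _] := stP r.
  by apply: (block_exists _ _ Minf ML); [exact: boolean_addxx | have [/(_ n)[]] := SP r].
have /choice[p pP] r : exists p : set_system nat, free_ultrafilter p /\
    forall X : set nat, (exists k, forall n, (k <= n)%N -> branch (code r) n ->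
      (#|` [fset m in I (r, n) | ~~ `[< X m >]]|%fset <= k * loss n)%N) -> p X.
  have [||q fq qP] := @block_ultrafilter (branch (code r)) (fun n => I (r, n)).
  - exact: branch_infinite.
  - by move=> n; have [] := IP (r, n).
  by exists q.
pose Phi := characters node (fun r => (st r).2) p.
have sep E : E <> 0 -> exists2 phi, Phi phi & phi E.
  apply: (@characters_separate _ _ code _ code_inj node_inj node_wf _ S (fun r n => I (r, n))).
  - by move=> r n; have [/(_ n)[]] := SP r.
  - by move=> r; have [] := SP r.
  - by move=> r n; have [] := IP (r, n).
  - by move=> r n; have [] := IP (r, n).
  - by move=> r; have [] := pP r.
  - by move=> r; have [] := pP r.
have PhiD phi : Phi phi -> {morph phi : x y / x + y} by case.
have real r : realizes (target r) (st r) Phi (p r).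
  have [fp large] := pP r; split => //; last by move=> g phi Lg [_]; apply.
  apply: large; exists 0%N => n _ _; rewrite leqn0 cardfs_eq0; apply/eqP/fsetP => m.
  rewrite !inE; apply/negbTE/negP => /andP[mI /asboolPn]; apply.
  by have [_ + _] := IP (r, n); apply.
exists (initial_topology_of Phi) => G; split.
- exact: initial_group_topology.
- exact: initial_hausdorff.
- move=> B [fB _] f.
  pose b n := if choice.unpickle n is Some s then `[< B s >] else false.
  pose a n : boolean_group T := if choice.unpickle n is Some s then f s else 0.
  have bB : coded_front b = B.
    by apply/seteqP; split => s; rewrite /coded_front /= /b choice.pickleK => /asboolP.
  have af : (fun t => a (choice.pickle t)) = f.
    by apply/funext => s; rewrite /a choice.pickleK.
  have [_ _ + _] := stP (b, a); rewrite /= bB af => /(_ fB)[x casx].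
  have [fp _] := pP (b, a); have [Up _] := fp.
  have pT : p (b, a) [set: nat] by exact: filterT.
  by exists (p (b, a)); split => //; exists x; exact: casx (real _) pT.
- move=> u x ux; apply: contrapT => noc.
  have addGG := @boolean_addxx T.
  pose a n : boolean_group T := (u n : boolean_group T) + (x : boolean_group T).
  have a0 phi : Phi phi -> finite_set [set n | phi (a n)].
    move=> Pphi; have [N _ NP] := ux _ (initial_nbhs1 x Pphi).
    apply/finite_set_natP; exists N => n /=; apply: contraTltn => /NP /= e.
    by rewrite (PhiD _ Pphi) e; case: (phi x).
  have afin y : y <> 0 -> finite_set [set n | a n = y].
    move=> /sep[phi Pphi phiy]; apply: sub_finite_set (a0 phi Pphi) => n /= ->.
    exact: phiy.
  have ainf : infinite_set [set n | a n <> 0].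
    move=> /finite_set_natP[N NP]; apply: noc; exists x; exists N => // n /= Nn.
    have an0 : a n = 0 by apply: contrapT => /NP; rewrite ltnNge Nn.
    by rewrite -[LHS](addVKV addGG (x : boolean_group T)) -/(a n) an0 add0r.
  pose r : label T := (fun=> false, a).
  have La : (st r).2 a.
    have [_ [_ +] _ _] := stP r; apply; rewrite /initial_state.
    by case: pselect => // -[].
  have [|phi Pphi phia] := sep (target r a).
    move=> /(congr1 (fun c => node r a \in (c : {fset T}))).
    by rewrite !inE eqxx.
  have [fp pM _ lim] := real r; have [Up _] := fp.
  have [n [/= an]] := filter_ex (filterI (free_ultrafilter_cofinite fp (a0 _ Pphi)) (lim _ _ La Pphi)).
  by rewrite phia; move/negP: an => /negbTE ->.
- move=> u.
  pose a n : boolean_group T :=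
    if @choice.unpickle (nat * nat)%type n is Some (k, m) then u m k else 0.
  pose r : label T := (fun=> false, a).
  have [_ _ _ /choice[x xP]] := stP r.
  have [fp _ _ _] := real r; have [Up _] := fp.
  exists x => U nU fin.
  have pU : p r [set n | U (u n)].
    apply: ptws_nbhs_limit nU => k W nW.
    have lim phi : Phi phi -> p r [set n | phi (u n k) = phi (x k)].
      move=> Pphi; have := decides_limit (real r) (xP k) Pphi.
      by apply: filterS => n /=; rewrite /a choice.pickleK.
    exact: (initial_limit _ lim nW).
  by have [n []] := filter_ex (filterI pU (free_ultrafilter_cofinite fp fin)).
Qed.
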